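(* Fix $1 \le r \le \infty$. Let $R$ be a partially ordered commutative ring, and let $\boldsymbol{\phi} = (\phi_i)_{i \ge 0}$ be a sequence in $R$ that is Toeplitz-totally positive of order $r$. Then: (a) The lower-triangular matrix $\mathsf{L}(\boldsymbol{\phi}) = (L_{n,k}(\boldsymbol{\phi}))_{n,k \ge 0}$ is totally positive of order $r$ in the ring $R$. (b) The sequence $(L_n(\boldsymbol{\phi},y))_{n \ge 0}$ is Hankel-totally positive of order $r$ in the ring $R[y]$ equipped with the coefficientwise order. (c) The sequence $(L_{n+1,1}(\boldsymbol{\phi}))_{n \ge 0}$ is Hankel-totally positive of order $r$ in the ring $R$.
   Context: A partially ordered commutative ring is a commutative ring $R$ (with $1 \ne 0$) together with a subset $\mathcal{P}$ (''nonnegative elements'') such that $0,1 \in \mathcal{P}$, $\mathcal{P}$ is closed under addition and multiplication, and $\mathcal{P} \cap (-\mathcal{P}) = \{0\}$. For indeterminates $y$, the coefficientwise order on $R[y]$ declares nonnegative the polynomials all of whose coefficients lie in $\mathcal{P}$. A (finite or infinite) matrix is totally positive of order $r$ (TP$_r$) if all its minors of size $\le r$ are nonnegative; TP$_\infty$ means all minors are nonnegative. A sequence $(a_n)_{n\ge0}$ is Hankel-TP$_r$ if the matrix $(a_{i+j})_{i,j\ge0}$ is TP$_r$, and Toeplitz-TP$_r$ if the matrix $(a_{i-j})_{i,j\ge 0}$ (with $a_n := 0$ for $n<0$) is TP$_r$. Generic Lah polynomials: an ordered tree is a rooted tree in which the children of each vertex are linearly ordered; an increasing ordered tree on a finite set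 of integers is an ordered tree whose vertices are bijectively labeled by that set so that every child has a larger label than its parent. For indeterminates $\boldsymbol{\phi}=(\phi_i)_{i\ge 0}$ and $n,k\ge 0$, $L_{n,k}(\boldsymbol{\phi}) \in \mathbb{Z}[\boldsymbol{\phi}]$ is the sum over all unordered forests of $k$ increasing ordered trees whose vertex sets partition $[n]=\{1,\dots,n\}$ of $\prod_{v} \phi_{\deg(v)}$, where $\deg(v)$ is the number of children of $v$ (so $L_{0,0}=1$, $L_{0,k}=0$ for $k\ge1$, $L_{n,0}=0$ for $n \ge 1$). Also $L_n(\boldsymbol{\phi},y) = \sum_{k=0}^n L_{n,k}(\boldsymbol{\phi})\, y^k$. For $\boldsymbol{\phi}$ with values in a ring $R$, these polynomials are evaluated by substitution. *)

(* Defs.v *)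
From HB Require Import structures.
From mathcomp Require Import all_boot all_order all_algebra.

Set Implicit Arguments.
Unset Strict Implicit.
Unset Printing Implicit Defensive.

Import GRing.Theory.
Local Open Scope ring_scope.

Record is_nonneg_cone (R : comNzRingType) (P : R -> Prop) : Prop := {
  cone0 : P 0;
  cone1 : P 1;
  coneD : forall x y, P x -> P y -> P (x + y);
  coneM : forall x y, P x -> P y -> P (x * y);
  cone_anti : forall x, P x -> P (- x) -> x = 0
}.

Definition coefwise (R : comNzRingType) (P : R -> Prop) (p : {poly R}) : Prop :=
  forall i : nat, P p`_i.

Lemma cone_sum (R : comNzRingType) (P : R -> Prop) (hP : is_nonneg_cone P)
    (I : finType) (F : I -> R) :
  (forall i, P (F i)) -> P (\sum_i F i).
Proof.
move=> PF; elim/big_ind: _ => [|x y|i _]; first exact: cone0.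
- exact: coneD.
- exact: PF.
Qed.

Lemma coefwise_cone (R : comNzRingType) (P : R -> Prop) :
  is_nonneg_cone P -> is_nonneg_cone (coefwise P).
Proof.
move=> hP; split.
- by move=> i; rewrite coef0; apply: cone0.
- by move=> i; rewrite coef1; case: eqP => _; [apply: cone1 | apply: cone0].
- by move=> p q hp hq i; rewrite coefD; apply: coneD.
- by move=> p q hp hq i; rewrite coefM; apply: cone_sum => // j; apply: coneM.
- move=> p hp hNp; apply/polyP => i; rewrite coef0.
  by apply: (cone_anti hP) => //; rewrite -coefN.
Qed.

(* An order of total positivity r, finite or infinite, is an [option nat]:
   [None] stands for r = oo. *)
Definition le_ord (m : nat) (r : option nat) : bool :=
  if r is Some s then (m <= s)%N else true.

(* Infinite matrices are functions [nat -> nat -> R]; a minor of size m is given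
   by strictly increasing families of m row indices and m column indices. *)
Definition minor (R : comNzRingType) (M : nat -> nat -> R) (m : nat)
    (rows cols : 'I_m -> nat) : R :=
  \det (\matrix_(i < m, j < m) M (rows i) (cols j)).

Definition TP (R : comNzRingType) (P : R -> Prop) (r : option nat)
    (M : nat -> nat -> R) : Prop :=
  forall (m : nat) (rows cols : 'I_m -> nat),
    le_ord m r ->
    {homo rows : i j / (i < j)%N} -> {homo cols : i j / (i < j)%N} ->
    P (minor M rows cols).

Definition hankel_mx (R : comNzRingType) (a : nat -> R) (i j : nat) : R :=
  a (i + j)%N.

Definition toeplitz_mx (R : comNzRingType) (a : nat -> R) (i j : nat) : R :=
  if (j <= i)%N then a (i - j)%N else 0.

Definition HankelTP (R : comNzRingType) (P : R -> Prop) (r : option nat)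
    (a : nat -> R) : Prop := TP P r (hankel_mx a).

Definition ToeplitzTP (R : comNzRingType) (P : R -> Prop) (r : option nat)
    (a : nat -> R) : Prop := TP P r (toeplitz_mx a).

(* Unordered forests of ordered trees on the vertex set 'I_n (vertex i carries
   the label i + 1) are given by the linearly ordered list [F u] of the children
   of each vertex u. The bound n on the length of the lists only serves to make
   the type finite: it is implied by [uniq (F u)]. *)
Definition child_lists (n : nat) := {ffun 'I_n -> {bseq n of 'I_n}}.

(* Every vertex occurs at most once among all the child lists, i.e. has at most
   one parent, and labels increase from parent to child; the latter excludes
   cycles. *)
Definition increasing_forest (n : nat) (F : child_lists n) : bool :=
  [&& [forall u, uniq (F u)],
      [forall v, forall u, forall w, (v \in F u) && (v \in F w) ==> (u == w)]
    & [forall u, forall v, (v \in F u) ==> (u < v)%N]].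

Definition roots (n : nat) (F : child_lists n) : {set 'I_n} :=
  [set v | [forall u, v \notin F u]].

Definition deg (n : nat) (F : child_lists n) (v : 'I_n) : nat := size (F v).

(* The trees of a forest correspond to its roots, so k trees means k roots. *)
Definition Lah (R : comNzRingType) (phi : nat -> R) (n k : nat) : R :=
  \sum_(F : child_lists n | increasing_forest F && (#|roots F| == k))
    \prod_(v < n) phi (deg F v).

Definition Lah_poly (R : comNzRingType) (phi : nat -> R) (n : nat) : {poly R} :=
  \sum_(k < n.+1) Lah phi n k *: 'X^k.

Lemma Lah0n (R : comNzRingType) (phi : nat -> R) (k : nat) :
  Lah phi 0 k = (k == 0%N)%:R.
Proof.
have F0 (F : child_lists 0) : F = [ffun=> [bseq]] by apply/ffunP=> -[].
have inc (F : child_lists 0) : increasing_forest F.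
  by apply/and3P; split; apply/forallP=> -[].
have rt (F : child_lists 0) : #|roots F| = 0%N.
  by apply/eqP; rewrite -leqn0; apply: leq_trans (max_card _) _; rewrite card_ord.
rewrite /Lah; under eq_bigl => F do rewrite inc rt /=.
case: k => [|k] /=; last by rewrite big_pred0.
rewrite (big_pred1 [ffun=> [bseq]]) ?big_ord0 // => F.
by rewrite eqxx; apply/esym/eqP/F0.
Qed.

Lemma LahS0 (R : comNzRingType) (phi : nat -> R) (n : nat) :
  Lah phi n.+1 0 = 0.
Proof.
rewrite /Lah big_pred0 // => F; apply/negP => /andP[/and3P[_ _ /forallP inc]].
rewrite cards_eq0 => /eqP rF0; suff: ord0 \in roots F by rewrite rF0 inE.
rewrite inE; apply/forallP => u; apply/negP => uF.
by have /forallP/(_ ord0) := inc u; rewrite uF.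
Qed.

(* Main.v *)
(* Deleting the smallest vertex of a forest, which is always a root, shows that
   row n+1 of the Lah matrix is row n times the production matrix p with
   p_(i,k) = i!/(k-1)! phi_(i-k+1): a forest with i trees gives
   i (i-1) ... k ordered lists of trees to be grafted on the new vertex.
   Up to a column shift, p is the Toeplitz matrix of phi rescaled by factorials,
   and the rescaling multiplies each minor by a natural number, so p is TP_r.
   By Cauchy-Binet and induction on the rows, the matrix (p^n)_(0,k) is TP_r,
   which is (a).  For any Hessenberg matrix q that is TP_r, the Hankel matrix of
   (q^n)_(0,0) is the product of ((q^n)_(0,k)) and ((q^n)_(k,0)), hence TP_r.
   For (b), take q = p (1 + y Delta^T) with Delta_(i,i+1) = 1, which is the
   conjugate of p by the matrix of the 'C(j,k) y^(j-k); for (c), delete row and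
   column 0 of p. *)

From mathcomp Require Import all_boot all_order all_fingroup all_algebra.
From mathcomp Require Import zify.
Require Import Defs.

Set Implicit Arguments.
Unset Strict Implicit.
Unset Printing Implicit Defensive.

Import GRing.Theory.
Local Open Scope ring_scope.

(** * The Cauchy-Binet formula *)

Definition increasing_ffun m n (g : {ffun 'I_m -> 'I_n}) : bool :=
  [forall i : 'I_m, forall j : 'I_m, (i < j)%N ==> (g i < g j)%N].

Lemma increasing_ffunP m n (g : {ffun 'I_m -> 'I_n}) :
  reflect {homo g : i j / (i < j)%N} (increasing_ffun g).
Proof.
apply: (iffP forallP) => [h i j ij|h i].
  by have /forallP/(_ j)/implyP := h i; apply.
by apply/forallP => j; apply/implyP; apply: h.
Qed.

Lemma increasing_ffun_mono m n (g : {ffun 'I_m -> 'I_n}) :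
  increasing_ffun g -> {mono g : i j / (i < j)%N}.
Proof.
move=> /increasing_ffunP h i j; case: (ltngtP i j) => [ij|ji|/val_inj->].
- by rewrite h.
- by apply/negbTE; rewrite -leqNgt ltnW // h.
- by rewrite ltnn.
Qed.

Lemma rank_ffun_subproof m n (f : {ffun 'I_m -> 'I_n}) (i : 'I_m) :
  (#|[set j | (f j < f i)%N]| < m)%N.
Proof.
rewrite -[X in (_ < X)%N]card_ord -cardsT; apply: proper_card.
by apply/properP; split; [exact: subsetT | exists i; rewrite ?inE ?ltnn].
Qed.

Definition rank_ffun m n (f : {ffun 'I_m -> 'I_n}) : {ffun 'I_m -> 'I_m} :=
  [ffun i => Ordinal (rank_ffun_subproof f i)].

(* An injective function is uniquely an increasing function composed with a
   permutation, namely its [rank_perm]. *)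
Definition rank_perm m n (f : {ffun 'I_m -> 'I_n}) : 'S_m :=
  insubd (1%g : 'S_m) (rank_ffun f).

Lemma rank_ffun_lt m n (f : {ffun 'I_m -> 'I_n}) i j :
  (f i < f j)%N -> (rank_ffun f i < rank_ffun f j)%N.
Proof.
move=> ij; rewrite !ffunE /=; apply: proper_card; apply/properP; split.
  by apply/subsetP => k; rewrite !inE => /ltn_trans; apply.
by exists i; rewrite !inE ?ltnn.
Qed.

Lemma rank_permE m n (f : {ffun 'I_m -> 'I_n}) :
  injective f -> rank_perm f =1 rank_ffun f.
Proof.
move=> injf i; have injr : injectiveb (rank_ffun f).
  apply/injectiveP => j k e; apply: injf; apply: val_inj => /=.
  by case: (ltngtP (f j) (f k)) => // /rank_ffun_lt; rewrite e ltnn.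
by rewrite -pvalE /rank_perm; have /= -> := insubdK (1%g : 'S_m) injr.
Qed.

Lemma rank_perm_comp m n (g : {ffun 'I_m -> 'I_n}) (s : 'S_m) :
  increasing_ffun g -> rank_perm [ffun i => g (s i)] = s.
Proof.
move=> gi; have gm := increasing_ffun_mono gi.
have gs_inj : injective [ffun i => g (s i)].
  move=> i j; rewrite !ffunE => e; apply: (@perm_inj _ s); apply: val_inj => /=.
  by case: (ltngtP (s i) (s j)) => //; rewrite -gm e ltnn.
apply/permP => i; rewrite rank_permE //; apply: val_inj; rewrite ffunE /=.
(* Since [g] preserves and reflects the order, the values below [g (s i)] correspond under [s] to
   the [s i] smaller indices. *)
have -> : [set j | ([ffun i => g (s i)] j < [ffun i => g (s i)] i)%N]
   = s @^-1: [set k : 'I_m | (k < s i)%N].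
  by apply/setP => j; rewrite !inE !ffunE gm.
rewrite card_preimset; last exact: perm_inj.
rewrite cardsE -sum1_card.
rewrite -(big_ord_widen m (fun=> 1%N) (ltnW (ltn_ord (s i)))).
by rewrite sum1_card card_ord.
Qed.

Lemma rank_perm_increasing m n (f : {ffun 'I_m -> 'I_n}) :
  injective f -> increasing_ffun [ffun i => f ((rank_perm f)^-1%g i)].
Proof.
move=> injf; apply/increasing_ffunP => i j; rewrite !ffunE.
rewrite -{1}(permKV (rank_perm f) i) -{1}(permKV (rank_perm f) j).
pose a := (rank_perm f)^-1%g i; pose b := (rank_perm f)^-1%g j.
rewrite -/a -/b !rank_permE //.
case: (ltngtP (f a) (f b)) => // [/rank_ffun_lt|/val_inj/injf ->].
  by case: ltngtP.
by rewrite ltnn.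
Qed.

Lemma det_mulmx_ffun (R : comNzRingType) m n (A : 'M[R]_(m, n))
    (B : 'M[R]_(n, m)) :
  \det (A *m B) =
    \sum_(f : {ffun 'I_m -> 'I_n}) (\prod_i A i (f i)) * \det (rowsub f B).
Proof.
rewrite /determinant.
under eq_bigr do
  (under eq_bigr do rewrite mxE; rewrite bigA_distr_bigA big_distrr /=).
rewrite exchange_big; apply: eq_bigr => f _; rewrite big_distrr /=.
apply: eq_bigr => s _; rewrite big_split /= mulrCA; congr (_ * (_ * _)).
by apply: eq_bigr => i _; rewrite mxE.
Qed.

Lemma det_rowsub_perm (R : comNzRingType) m n (B : 'M[R]_(n, m))
    (g : {ffun 'I_m -> 'I_n}) (s : 'S_m) :
  \det (rowsub [ffun i => g (s i)] B) = (-1) ^+ s * \det (rowsub g B).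
Proof.
rewrite -det_perm -det_mulmx -row_permE; congr (\det _).
by apply/matrixP => i j; rewrite !mxE ffunE.
Qed.

(** In the expansion over all maps [f], a non-injective [f] repeats a row of [B] and contributes 0.
    An injective [f] is [g] composed with a permutation [s]; the sign of [s] moves to the product of
    entries of [A], and summing over [s] rebuilds the minor of [A]. *)
Lemma Cauchy_Binet (R : comNzRingType) m n (A : 'M[R]_(m, n))
    (B : 'M[R]_(n, m)) :
  \det (A *m B) =
    \sum_(g : {ffun 'I_m -> 'I_n} | increasing_ffun g)
      \det (colsub g A) * \det (rowsub g B).
Proof.
rewrite det_mulmx_ffun (bigID (fun f : {ffun 'I_m -> 'I_n} => injectiveb f)) /=.
rewrite [X in _ + X]big1 ?addr0; last first.
  move=> f /injectivePn[i [j ij e]].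
  rewrite (@determinant_alternate _ _ _ i j) ?mulr0 //.
  by move=> k; rewrite !mxE e.
rewrite (partition_big (@rank_perm m n) xpredT) //=.
transitivity (\sum_(s : 'S_m) \sum_(g : {ffun 'I_m -> 'I_n} | increasing_ffun g)
   ((-1) ^+ s * \prod_i A i (g (s i))) * \det (rowsub g B)).
  apply: eq_bigr => s _.
  rewrite (reindex_onto (fun g : {ffun 'I_m -> 'I_n} => [ffun i => g (s i)])
     (fun f => [ffun i => f (s^-1%g i)])); last first.
    by move=> f _; apply/ffunP => i; rewrite !ffunE permK.
  apply: eq_big => [g|g _]; last first.
    rewrite det_rowsub_perm mulrCA mulrA; congr (_ * _ * _).
    by apply: eq_bigr => i _; rewrite ffunE.
  have -> : [ffun i => [ffun i0 => g (s i0)] (s^-1%g i)] = g.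
    by apply/ffunP => i; rewrite !ffunE permKV.
  rewrite eqxx andbT; apply/andP/idP => [[/injectiveP inj /eqP e]|gi].
    have := rank_perm_increasing inj; rewrite e; congr increasing_ffun.
    by apply/ffunP => i; rewrite !ffunE permKV.
  split; last by rewrite rank_perm_comp.
  apply/injectiveP => i j; rewrite !ffunE => e; apply: (@perm_inj _ s).
  apply: val_inj => /=; have gm := increasing_ffun_mono gi.
  by case: (ltngtP (s i) (s j)) => //; rewrite -gm e ltnn.
rewrite exchange_big; apply: eq_bigr => g _; rewrite -big_distrl /=; congr (_ * _).
by apply: eq_bigr => s _; congr (_ * _); apply: eq_bigr => i _; rewrite mxE.
Qed.

(** * Total positivity *)

Lemma cone_sum_cond (R : comNzRingType) (P : R -> Prop) (hP : is_nonneg_cone P)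
    (I : finType) (Q : pred I) (F : I -> R) :
  (forall i, Q i -> P (F i)) -> P (\sum_(i | Q i) F i).
Proof.
move=> PF; elim/big_ind: _ => //; first exact: cone0.
by move=> x y; apply: coneD.
Qed.

Lemma cone_natr (R : comNzRingType) (P : R -> Prop) (hP : is_nonneg_cone P) n :
  P n%:R.
Proof.
elim: n => [|n IHn]; first exact: cone0.
by rewrite -natr1; apply: coneD => //; apply: cone1.
Qed.

Lemma cone_exp (R : comNzRingType) (P : R -> Prop) (hP : is_nonneg_cone P) x n :
  P x -> P (x ^+ n).
Proof.
move=> Px; elim: n => [|n IHn]; first exact: cone1.
by rewrite exprS; apply: coneM.
Qed.

Lemma minor0 (R : comNzRingType) (M : nat -> nat -> R) (rows cols : 'I_0 -> nat) :
  minor M rows cols = 1.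
Proof. exact: det_mx00. Qed.

Lemma eq_minor (R : comNzRingType) (M M' : nat -> nat -> R) m
    (rows cols rows' cols' : 'I_m -> nat) :
  (forall i j, M (rows i) (cols j) = M' (rows' i) (cols' j)) ->
  minor M rows cols = minor M' rows' cols'.
Proof.
by move=> h; congr (\det _); apply/matrixP => i j; rewrite !mxE.
Qed.

Lemma minor_tr (R : comNzRingType) (M : nat -> nat -> R) m
    (rows cols : 'I_m -> nat) :
  minor M rows cols = minor (fun i j => M j i) cols rows.
Proof.
by rewrite /minor -det_tr; congr (\det _); apply/matrixP => i j; rewrite !mxE.
Qed.

Lemma minor_first_row (R : comNzRingType) (M : nat -> nat -> R) m
    (rows cols : 'I_m.+1 -> nat) :
  (forall j, j != ord0 -> M (rows ord0) (cols j) = 0) ->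
  minor M rows cols = M (rows ord0) (cols ord0) *
    minor M (fun i => rows (lift ord0 i)) (fun j => cols (lift ord0 j)).
Proof.
move=> h; rewrite /minor (expand_det_row _ ord0) (bigD1 ord0) //= big1 ?addr0.
  rewrite mxE /cofactor expr0 mul1r; congr (_ * \det _).
  by apply/matrixP => i j; rewrite !mxE.
by move=> j hj; rewrite mxE h // mul0r.
Qed.

Lemma minor_first_col (R : comNzRingType) (M : nat -> nat -> R) m
    (rows cols : 'I_m.+1 -> nat) :
  (forall i, i != ord0 -> M (rows i) (cols ord0) = 0) ->
  minor M rows cols = M (rows ord0) (cols ord0) *
    minor M (fun i => rows (lift ord0 i)) (fun j => cols (lift ord0 j)).
Proof. by move=> h; rewrite minor_tr minor_first_row // -minor_tr. Qed.

Lemma minor_prod (R : comNzRingType) (A B C : nat -> nat -> R) m n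
    (rows cols : 'I_m -> nat) :
  (forall i j, C (rows i) (cols j) = \sum_(k < n) A (rows i) k * B k (cols j)) ->
  minor C rows cols =
    \sum_(g : {ffun 'I_m -> 'I_n} | increasing_ffun g)
      minor A rows (fun i => g i) * minor B (fun i => g i) cols.
Proof.
move=> h.
have -> : minor C rows cols =
    \det ((\matrix_(i < m, k < n) A (rows i) k) *m (\matrix_(k, j) B k (cols j))).
  congr (\det _); apply/matrixP => i j; rewrite !mxE h.
  by apply: eq_bigr => k _; rewrite !mxE.
rewrite Cauchy_Binet; apply: eq_bigr => g _.
by congr (_ * _); congr (\det _); apply/matrixP => i j; rewrite !mxE.
Qed.

(* [C] is the product of the infinite matrices [A] and [B], where the sum
   defining [C i k] may be truncated at any [N >= b i k]. *)
Definition is_mxprod (R : comNzRingType) (b : nat -> nat -> nat)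
    (A B C : nat -> nat -> R) : Prop :=
  forall i k N, (b i k <= N)%N -> C i k = \sum_(j < N) A i j * B j k.

(** Cauchy-Binet, after truncating the product at a bound valid for all entries of the minor.
    Positivity is assumed only for the given rows of [A] and columns of [B], so that an induction on
    the rows can supply it. *)
Lemma minor_mxprod_cone (R : comNzRingType) (P : R -> Prop)
    (hP : is_nonneg_cone P) b (A B C : nat -> nat -> R) m
    (rows cols : 'I_m -> nat) :
  is_mxprod b A B C ->
  (forall g : 'I_m -> nat, {homo g : i j / (i < j)%N} -> P (minor A rows g)) ->
  (forall g : 'I_m -> nat, {homo g : i j / (i < j)%N} -> P (minor B g cols)) ->
  P (minor C rows cols).
Proof.
move=> hC hA hB; pose n := (\max_i \max_j b (rows i) (cols j))%N.
rewrite (@minor_prod _ A B _ _ n).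
  apply: cone_sum_cond => // g /increasing_ffunP hg.
  by apply: coneM => //; [apply: hA | apply: hB] => i j; apply: hg.
move=> i j; apply: hC; apply: leq_trans (leq_bigmax i).
exact: (@leq_bigmax _ (fun j => b (rows i) (cols j))).
Qed.

Lemma TP_mxprod (R : comNzRingType) (P : R -> Prop) (hP : is_nonneg_cone P) r b
    (A B C : nat -> nat -> R) :
  is_mxprod b A B C -> TP P r A -> TP P r B -> TP P r C.
Proof.
move=> hC hA hB m rows cols hm hrows hcols.
by apply: (minor_mxprod_cone hP hC) => g hg; [apply: hA | apply: hB].
Qed.

Lemma eq_TP (R : comNzRingType) (P : R -> Prop) r (A B : nat -> nat -> R) :
  (forall i j, A i j = B i j) -> TP P r A -> TP P r B.
Proof.
move=> e hA m rows cols *; rewrite -(@eq_minor _ A _ m rows cols) //.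
exact: hA.
Qed.

Lemma TP_tr (R : comNzRingType) (P : R -> Prop) r (A : nat -> nat -> R) :
  TP P r A -> TP P r (fun i j => A j i).
Proof. by move=> hA m rows cols *; rewrite -minor_tr; apply: hA. Qed.

Lemma TP_shift (R : comNzRingType) (P : R -> Prop) r (A : nat -> nat -> R) :
  TP P r A -> TP P r (fun i j => A i.+1 j.+1).
Proof. by move=> hA m rows cols hm hr hc; apply: (hA m (S \o rows) (S \o cols)). Qed.

Lemma TP_scale (R : comNzRingType) (P : R -> Prop) (hP : is_nonneg_cone P) r x
    (A : nat -> nat -> R) :
  P x -> TP P r A -> TP P r (fun i j => x * A i j).
Proof.
move=> Px hA m rows cols hm hr hc.
have -> : minor (fun i j => x * A i j) rows cols = x ^+ m * minor A rows cols.
  by rewrite /minor -detZ; congr (\det _); apply/matrixP => i j; rewrite !mxE.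
by apply: coneM => //; [apply: cone_exp | apply: hA].
Qed.

Lemma TP_polyC (R : comNzRingType) (P : R -> Prop) (hP : is_nonneg_cone P) r
    (A : nat -> nat -> R) :
  TP P r A -> TP (coefwise P) r (fun i j => (A i j)%:P).
Proof.
move=> hA m rows cols hm hr hc.
have -> : minor (fun i j => (A i j)%:P) rows cols = (minor A rows cols)%:P.
  rewrite /minor -det_map_mx; congr (\det _).
  by apply/matrixP => i j; rewrite !mxE.
move=> i; rewrite coefC; case: ifP => _; last exact: cone0.
exact: hA.
Qed.

Lemma TP_zero_col (R : comNzRingType) (P : R -> Prop) (hP : is_nonneg_cone P) r
    (A : nat -> nat -> R) :
  TP P r A -> TP P r (fun i k => if k is k'.+1 then A i k' else 0).
Proof.
move=> hA [|m] rows cols hm hr hc; first by rewrite minor0; apply: cone1.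
have [c0|c0] := posnP (cols ord0).
  rewrite minor_first_col c0 ?mul0r; last by move=> i _.
  exact: cone0.
have cpos j : (0 < cols j)%N.
  have [->//|] := eqVneq j ord0; rewrite -lt0n => /(hc ord0 j).
  exact: leq_ltn_trans.
rewrite (@eq_minor _ _ A _ rows cols rows (fun j => (cols j).-1)) //.
  by apply: hA => // i j /hc; have := cpos i; case: (cols i) (cols j) => // ? [].
by move=> i j; case: (cols j) (cpos j).
Qed.

(** Induction on the size: depending on how the first row index compares with the first column
    index, the first row or the first column of the minor vanishes beyond its corner, and expansion
    leaves a smaller minor. *)
Lemma TP_bidiagonal (R : comNzRingType) (P : R -> Prop) (hP : is_nonneg_cone P) r
    (x : R) :
  P x -> TP P r (fun i j => (i == j)%:R + x * (i == j.+1)%:R).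
Proof.
move=> Px m; elim: m => [|m IHm] rows cols hm hr hc.
  by rewrite minor0; apply: cone1.
set M := fun _ _ => _ : R.
have rowsP i : i != ord0 -> (rows ord0 < rows i)%N.
  by rewrite -lt0n => /(hr ord0 i).
have colsP i : i != ord0 -> (cols ord0 < cols i)%N.
  by rewrite -lt0n => /(hc ord0 i).
have PM i j : P (M i j).
  apply: coneD => //; first exact: cone_natr.
  by apply: coneM => //; apply: cone_natr.
have Prest : P (minor M (fun i => rows (lift ord0 i)) (fun j => cols (lift ord0 j))).
  apply: IHm => [|i j ij|i j ij]; last 2 first.
  - by apply: hr; rewrite !lift0 ltnS.
  - by apply: hc; rewrite !lift0 ltnS.
  by case: r hm => //= s; apply: ltnW.
case: (leqP (rows ord0) (cols ord0)) => [rc|cr].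
  rewrite minor_first_row; first by apply: coneM.
  move=> j /colsP hj; rewrite /M !ltn_eqF; last 2 first.
  - by rewrite ltnS; apply: leq_trans rc (ltnW hj).
  - exact: leq_ltn_trans hj.
  by rewrite mulr0 addr0.
rewrite minor_first_col; first by apply: coneM.
move=> i /rowsP hi; rewrite /M !gtn_eqF ?mulr0 ?addr0 //.
  exact: leq_ltn_trans hi.
exact: ltn_trans hi.
Qed.

(* Termwise in the Leibniz expansion: a nonzero term satisfies [cols (s i) <=
   rows i] for all [i], and then its scaling factor is the quotient of the
   products of factorials, whatever the permutation [s]. *)
Lemma TP_ffact_scale (R : comNzRingType) (P : R -> Prop) (hP : is_nonneg_cone P) r
    (A : nat -> nat -> R) :
  (forall i j, (i < j)%N -> A i j = 0) ->
  TP P r A -> TP P r (fun i j => (i ^_ (i - j))%:R * A i j).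
Proof.
move=> A0 hA m rows cols hm hr hc.
(* This division is exact as soon as one permutation satisfies the inequalities above; the terms of
   all other permutations vanish on both sides. *)
pose c := ((\prod_i (rows i)`!) %/ (\prod_i (cols i)`!))%N.
have -> : minor (fun i j => (i ^_ (i - j))%:R * A i j) rows cols
    = c%:R * minor A rows cols; last first.
  by apply: coneM => //; [exact: cone_natr | apply: hA].
rewrite /minor /determinant big_distrr /=; apply: eq_bigr => s _.
rewrite mulrCA; congr (_ * _).
under eq_bigr do rewrite mxE; under [in RHS]eq_bigr do rewrite mxE.
rewrite big_split /=.
have [/forallP le_cr|/forallPn[i]] := boolP [forall i, cols (s i) <= rows i]%N.
  rewrite -natr_prod; congr (_%:R * _); apply/eqP.
  rewrite /c [X in (_ %/ X)%N](reindex_inj (@perm_inj _ s)) /=.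
  have -> : (\prod_i (rows i)`! =
      \prod_i rows i ^_ (rows i - cols (s i)) * \prod_i (cols (s i))`!)%N.
    rewrite -big_split; apply: eq_bigr => i _ /=.
    by rewrite -[X in _ = (_ * X`!)%N](subKn (le_cr i)) ffact_fact ?leq_subr.
  by rewrite mulnK // prodn_gt0 // => i; apply: fact_gt0.
rewrite -ltnNge => h.
suff -> : \prod_i A (rows i) (cols (s i)) = 0 by rewrite !mulr0.
by rewrite (bigD1 i) //= A0 // mul0r.
Qed.

(** * Output matrices *)

(* Row [n] is the top row of the [n]-th power of [Q]. *)
Fixpoint output (R : comNzRingType) (Q : nat -> nat -> R) (n k : nat) : R :=
  if n is n'.+1 then \sum_(i < n'.+1) output Q n' i * Q i k else (k == 0%N)%:R.

(* Row [j] is the first column of the [j]-th power of [Q]. *)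
Fixpoint output_col (R : comNzRingType) (Q : nat -> nat -> R) (j k : nat) : R :=
  if j is j'.+1 then \sum_(i < k.+2) Q k i * output_col Q j' i
  else (k == 0%N)%:R.

Definition hessenberg (R : comNzRingType) (Q : nat -> nat -> R) : Prop :=
  forall i k, (i.+1 < k)%N -> Q i k = 0.

Lemma sum_ord_widen (R : comNzRingType) n N (F : nat -> R) :
  (n <= N)%N -> (forall i, (n <= i)%N -> F i = 0) ->
  \sum_(i < n) F i = \sum_(i < N) F i.
Proof.
move=> nN F0; rewrite (big_ord_widen N F nN).
rewrite [RHS](bigID (fun i : 'I_N => i < n)%N) /=.
by rewrite [X in _ + X]big1 ?addr0 // => i; rewrite -leqNgt => /F0.
Qed.

Lemma output_eq0 (R : comNzRingType) (Q : nat -> nat -> R) :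
  hessenberg Q -> forall n k, (n < k)%N -> output Q n k = 0.
Proof.
move=> hQ [|n] k nk /=; first by case: k nk.
rewrite big1 // => i _; rewrite hQ ?mulr0 //.
by apply: leq_ltn_trans nk; exact: ltn_ord.
Qed.

Lemma output_mxprod (R : comNzRingType) (Q : nat -> nat -> R) :
  hessenberg Q ->
  is_mxprod (fun n _ => n.+1) (output Q) Q (fun n => output Q n.+1).
Proof.
move=> hQ n k N nN /=.
apply: (@sum_ord_widen _ _ _ (fun i => output Q n i * Q i k)) => //.
by move=> i ni; rewrite output_eq0 ?mul0r.
Qed.

Lemma output_col_mxprod (R : comNzRingType) (Q : nat -> nat -> R) :
  hessenberg Q ->
  is_mxprod (fun _ k => k.+2) (output_col Q) (fun i k => Q k i)
    (fun n => output_col Q n.+1).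
Proof.
move=> hQ n k N nN /=.
rewrite (@sum_ord_widen _ _ _ (fun i => Q k i * output_col Q n i) nN).
  by apply: eq_bigr => i _; rewrite mulrC.
by move=> i ki; rewrite hQ ?mul0r.
Qed.

(** Induction on a bound for the row indices: rows [n.+1] of [A] are rows [n] of [A] times [Q], so
    Cauchy-Binet lowers the rows of a minor by one, once row 0 is removed. Applied to both [output]
    and the transpose of [Q] with [output_col]. *)
Lemma TP_recurrence (R : comNzRingType) (P : R -> Prop) (hP : is_nonneg_cone P) r b
    (A Q : nat -> nat -> R) :
  (forall k, A 0%N k = (k == 0%N)%:R) -> is_mxprod b A Q (fun n => A n.+1) ->
  TP P r Q -> TP P r A.
Proof.
move=> A0 hA hQ.
have main N m (rows cols : 'I_m -> nat) : le_ord m r ->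
    {homo rows : i j / (i < j)%N} -> {homo cols : i j / (i < j)%N} ->
    (forall i, rows i < N)%N -> P (minor A rows cols); last first.
  move=> m rows cols hm hr hc; apply: (main (\max_i rows i).+1%N) => // i.
  by rewrite ltnS leq_bigmax.
elim: N m rows cols => [|N IHN] m rows cols hm hr hc hN.
  case: m rows cols {hm hr hc} hN => [|m] rows cols hN; last by have := hN ord0.
  by rewrite minor0; apply: cone1.
have pos m' (rows' cols' : 'I_m' -> nat) : le_ord m' r ->
    {homo rows' : i j / (i < j)%N} -> {homo cols' : i j / (i < j)%N} ->
    (forall i, 0 < rows' i <= N)%N -> P (minor A rows' cols').
  move=> hm' hr' hc' hN'.
  rewrite (@eq_minor _ _ (fun n => A n.+1) _ _ _ (fun i => (rows' i).-1) cols') //.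
    apply: (minor_mxprod_cone hP hA) => g hg; last exact: hQ.
    apply: IHN => // [i j /hr'|i]; have := hN' i; case: (rows' i) => //=.
    by move=> k _; case: (rows' j).
  by move=> i j; have := hN' i; case: (rows' i).
case: m rows cols hm hr hc hN => [|m] rows cols hm hr hc hN.
  by rewrite minor0; apply: cone1.
have [r0|r0] := posnP (rows ord0); last first.
  apply: pos => // i; rewrite -[(_ <= N)%N]ltnS hN andbT.
  have [->//|] := eqVneq i ord0; rewrite -lt0n => /(hr ord0 i).
  exact: leq_ltn_trans.
(* Row 0 of [A] is a unit vector supported in column 0, so only the corner of the minor can be
   nonzero in this row. *)
rewrite minor_first_row r0 => [|j]; last first.
  rewrite -lt0n A0 => /(hc ord0 j) h; rewrite gtn_eqF //.
  exact: leq_ltn_trans h.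
apply: coneM => //; first by rewrite A0; apply: cone_natr.
apply: pos => [|i j ij|i j ij|i].
- by case: r hm {hQ IHN} => //= s; apply: ltnW.
- by apply: hr; rewrite !lift0 ltnS.
- by apply: hc; rewrite !lift0 ltnS.
- by rewrite -[(_ <= N)%N]ltnS hN andbT -r0; apply: hr.
Qed.

Lemma TP_output (R : comNzRingType) (P : R -> Prop) (hP : is_nonneg_cone P) r
    (Q : nat -> nat -> R) :
  hessenberg Q -> TP P r Q -> TP P r (output Q).
Proof. by move=> hQ; apply: (TP_recurrence hP _ (output_mxprod hQ)). Qed.

(** The entry at (0,0) of the power [i + j] of [Q] is split as row 0 of the power [i] times column 0
    of the power [j]. Induction on [j] moves one factor [Q] from the right to the left, which raises
    the truncation bound by one. *)
Lemma output_mul_col (R : comNzRingType) (Q : nat -> nat -> R) :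
  hessenberg Q ->
  is_mxprod (fun i _ => i.+1) (output Q) (fun k j => output_col Q j k)
    (hankel_mx (fun n => output Q n 0)).
Proof.
move=> hQ i j; elim: j i => [|j IHj] i N iN; rewrite /hankel_mx.
  rewrite addn0; case: N iN => // N _.
  by rewrite big_ord_recl /= mulr1 big1 ?addr0 // => k _; rewrite mulr0.
rewrite addnS -addSn -/(hankel_mx (fun n => output Q n 0) i.+1 j).
rewrite (IHj i.+1 N.+1) //.
under eq_bigr do rewrite (output_mxprod hQ iN) big_distrl /=.
rewrite exchange_big; apply: eq_bigr => k _ /=.
have kN : (k.+2 <= N.+1)%N by rewrite ltnS.
rewrite (@sum_ord_widen _ _ _ (fun l => Q k l * output_col Q j l) kN).
  by rewrite big_distrr; apply: eq_bigr => l _; rewrite /= mulrA.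
by move=> l kl; rewrite hQ ?mul0r.
Qed.

Lemma HankelTP_output (R : comNzRingType) (P : R -> Prop) (hP : is_nonneg_cone P) r
    (Q : nat -> nat -> R) :
  hessenberg Q -> TP P r Q -> HankelTP P r (fun n => output Q n 0).
Proof.
move=> hQ TPQ; apply: (TP_mxprod hP (output_mul_col hQ)); first exact: TP_output.
apply: TP_tr; apply: (TP_recurrence hP _ (output_col_mxprod hQ)) => //.
exact: TP_tr.
Qed.

(** * The recurrence for the generic Lah polynomials *)

Lemma val_insub_bseq (T : Type) n (s : seq T) :
  (size s <= n)%N -> val (insub_bseq n s) = s.
Proof. by move=> sn; rewrite insubdK. Qed.

Lemma card_uniq_bseqs (T : finType) n d (A : pred T) : (d <= n)%N ->
  #|[set s : {bseq n of T} | [&& all A s, uniq s & size s == d]]| = #|A| ^_ d.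
Proof.
move=> dn; rewrite -card_uniq_tuples.
have valE (t : d.-tuple T) : val (insub_bseq n t) = t.
  by rewrite val_insub_bseq // size_tuple.
rewrite -(@card_imset _ _ (fun t : d.-tuple T => insub_bseq n t)); last first.
  by move=> t t' /(congr1 val); rewrite !valE => /val_inj.
apply: eq_card => s; apply/idP/imsetP => [|[t]].
  rewrite inE => /and3P[sA su /eqP sd].
  exists (Tuple (introT eqP sd)); first by rewrite inE /= sA su.
  by apply: val_inj; rewrite valE.
by rewrite !inE => /andP[tA tu] ->; rewrite valE tA tu size_tuple /=.
Qed.

Definition lift_bseq n (s : {bseq n of 'I_n}) : {bseq n.+1 of 'I_n.+1} :=
  insub_bseq n.+1 (map (lift ord0) s).

Definition unlift_bseq n (s : {bseq n.+1 of 'I_n.+1}) : {bseq n of 'I_n} :=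
  insub_bseq n (pmap (unlift ord0) s).

Lemma val_lift_bseq n (s : {bseq n of 'I_n}) :
  val (lift_bseq s) = map (lift ord0) s.
Proof. by rewrite val_insub_bseq // size_map (leq_trans (size_bseq s)). Qed.

Lemma size_lift_bseq n (s : {bseq n of 'I_n}) : size (lift_bseq s) = size s.
Proof. by rewrite val_lift_bseq size_map. Qed.

Lemma uniq_lift_bseq n (s : {bseq n of 'I_n}) : uniq (lift_bseq s) = uniq s.
Proof. by rewrite val_lift_bseq map_inj_uniq //; apply: lift_inj. Qed.

Lemma mem_lift_bseq n (s : {bseq n of 'I_n}) v :
  (lift ord0 v \in lift_bseq s) = (v \in s).
Proof.
rewrite -[LHS]/(_ \in val (lift_bseq s)) val_lift_bseq mem_map //.
exact: lift_inj.
Qed.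

Lemma ord0_lift_bseq n (s : {bseq n of 'I_n}) : (ord0 \in lift_bseq s) = false.
Proof.
rewrite -[LHS]/(_ \in val (lift_bseq s)) val_lift_bseq.
by apply/mapP => -[v _ /(congr1 val)].
Qed.

Lemma lift_bseqK n : cancel (@lift_bseq n) (@unlift_bseq n).
Proof.
move=> s; apply: val_inj.
rewrite /unlift_bseq val_lift_bseq map_pK ?val_insub_bseq //.
  exact: size_bseq.
exact: liftK.
Qed.

Lemma unlift_bseqK n (s : {bseq n.+1 of 'I_n.+1}) :
  uniq s -> ord0 \notin s -> lift_bseq (unlift_bseq s) = s.
Proof.
move=> su s0.
have eqs : map (lift ord0) (pmap (unlift ord0) s) = s.
  rewrite (pmap_filter (f := unlift ord0) (g := lift ord0)); last first.
    by move=> v; case: unliftP.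
  apply/all_filterP/allP => v vs; case: unliftP => // v0.
  by rewrite -v0 vs in s0.
(* This bound, a consequence of [uniq s], keeps [insub_bseq] from returning its default value. *)
have size_n : (size (pmap (unlift ord0) s) <= n)%N.
  have : uniq (pmap (unlift ord0) s).
    by rewrite -eqs map_inj_uniq in su => //; apply: lift_inj.
  by move/card_uniqP <-; rewrite -[X in (_ <= X)%N]card_ord max_card.
by apply: val_inj; rewrite val_lift_bseq val_insub_bseq // eqs.
Qed.

(* The forest on [n.+1] vertices obtained from the forest [p.1] by adding a new
   minimal vertex with list of children [p.2]. *)
Definition attach n (p : child_lists n * {bseq n of 'I_n}) : child_lists n.+1 :=
  [ffun v => lift_bseq (if unlift ord0 v is Some u then p.1 u else p.2)].

Definition detach n (F : child_lists n.+1) : child_lists n * {bseq n of 'I_n} :=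
  ([ffun u => unlift_bseq (F (lift ord0 u))], unlift_bseq (F ord0)).

Lemma attach0 n (p : child_lists n * {bseq n of 'I_n}) :
  attach p ord0 = lift_bseq p.2.
Proof. by rewrite ffunE unlift_none. Qed.

Lemma attach_lift n (p : child_lists n * {bseq n of 'I_n}) u :
  attach p (lift ord0 u) = lift_bseq (p.1 u).
Proof. by rewrite ffunE liftK. Qed.

Lemma attachK n : cancel (@attach n) (@detach n).
Proof.
move=> [G s]; rewrite /detach attach0 lift_bseqK; congr pair.
by apply/ffunP => u; rewrite ffunE attach_lift lift_bseqK.
Qed.

Lemma increasing_forestP n (F : child_lists n) :
  reflect [/\ forall u, uniq (F u),
              forall v u w, v \in F u -> v \in F w -> u = w
            & forall u v, v \in F u -> (u < v)%N]
          (increasing_forest F).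
Proof.
apply: (iffP and3P) => -[h1 h2 h3]; split.
- exact/forallP.
- move=> v u w vu vw; apply/eqP.
  by move/forallP/(_ v)/forallP/(_ u)/forallP/(_ w)/implyP: h2; apply; rewrite vu.
- by move=> u v vu; move/forallP/(_ u)/forallP/(_ v)/implyP: h3; apply.
- exact/forallP.
- apply/forallP => v; apply/forallP => u; apply/forallP => w.
  by apply/implyP => /andP[vu vw]; apply/eqP; apply: h2 vu vw.
- by apply/forallP => u; apply/forallP => v; apply/implyP; apply: h3.
Qed.

Lemma detachK n (F : child_lists n.+1) :
  increasing_forest F -> attach (detach F) = F.
Proof.
move=> /increasing_forestP[Fu _ Fi].
(* The smallest label is nobody's child, so deleting it loses nothing from the other lists. *)
have F0 u : ord0 \notin F u by apply/negP => /Fi.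
by apply/ffunP => v; rewrite ffunE; case: unliftP => [u ->|->];
  rewrite ?ffunE unlift_bseqK.
Qed.

Lemma rootsP n (F : child_lists n) v :
  reflect (forall u, v \notin F u) (v \in roots F).
Proof. by rewrite inE; apply: forallP. Qed.

(** Labels increase automatically below a new minimal vertex. Uniqueness of parents forces its
    children to be parentless in [G], that is, roots. *)
Lemma increasing_attach n (G : child_lists n) (s : {bseq n of 'I_n}) :
  increasing_forest (attach (G, s)) =
    increasing_forest G && (all (mem (roots G)) s && uniq s).
Proof.
apply/increasing_forestP/and3P =>
  [[Fu Fp Fi]|[/increasing_forestP[Gu Gp Gi] sG su]].
  split; last by have := Fu ord0; rewrite attach0 uniq_lift_bseq.
  - apply/increasing_forestP; split.
    + by move=> u; have := Fu (lift ord0 u); rewrite attach_lift uniq_lift_bseq.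
    + move=> v u w vu vw; apply: (@lift_inj _ ord0).
      by apply: (Fp (lift ord0 v)); rewrite attach_lift mem_lift_bseq.
    + move=> u v vu; have := Fi (lift ord0 u) (lift ord0 v).
      by rewrite attach_lift mem_lift_bseq !lift0 ltnS; apply.
  - apply/allP => v vs; apply/rootsP => u; apply/negP => vu.
    have /(congr1 val) // : ord0 = lift ord0 u.
    by apply: (Fp (lift ord0 v)); rewrite ?attach0 ?attach_lift mem_lift_bseq.
split.
- by move=> u; case: (unliftP ord0 u) => [u' ->|->];
    rewrite ?attach0 ?attach_lift uniq_lift_bseq.
- have sG' v u : v \in s -> v \in G u -> False.
    by move=> vs; have /rootsP/(_ u)/negP := allP sG _ vs.
  move=> v u w; case: (unliftP ord0 u) => [u' ->|->];
    case: (unliftP ord0 w) => [w' ->|->] //; case: (unliftP ord0 v) => [v' ->|->];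
    rewrite ?attach0 ?attach_lift ?ord0_lift_bseq // !mem_lift_bseq /=.
  + by move=> vu vw; congr lift; apply: Gp vu vw.
  + by move=> vu vs; case: (sG' _ _ vs vu).
  + by move=> vs vu; case: (sG' _ _ vs vu).
- move=> u v; case: (unliftP ord0 u) => [u' ->|->];
    case: (unliftP ord0 v) => [v' ->|->];
    rewrite ?attach0 ?attach_lift ?ord0_lift_bseq // mem_lift_bseq !lift0 //.
  exact: Gi.
Qed.

Lemma roots_attach n (G : child_lists n) (s : {bseq n of 'I_n}) :
  roots (attach (G, s)) = ord0 |: lift ord0 @: (roots G :\: [set v in s]).
Proof.
apply/setP => v; case: (unliftP ord0 v) => [v' ->|->]; rewrite in_setU1.
  rewrite eq_sym (negbTE (neq_lift _ _)) /= mem_imset; last exact: lift_inj.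
  rewrite in_setD [v' \in finset _]inE; apply/rootsP/andP => [h|[vs /rootsP vG] u].
    split; first by have := h ord0; rewrite attach0 mem_lift_bseq.
    by apply/rootsP => u; have := h (lift ord0 u); rewrite attach_lift mem_lift_bseq.
  case: (unliftP ord0 u) => [u' ->|->]; rewrite ?attach0 ?attach_lift mem_lift_bseq //.
rewrite eqxx; apply/rootsP => u.
by case: (unliftP ord0 u) => [u' ->|->]; rewrite ?attach0 ?attach_lift ord0_lift_bseq.
Qed.

Lemma card_roots_attach n (G : child_lists n) (s : {bseq n of 'I_n}) :
  all (mem (roots G)) s -> uniq s ->
  #|roots (attach (G, s))| = (#|roots G| - size s).+1.
Proof.
move=> sG su; rewrite roots_attach cardsU1 card_imset; last exact: lift_inj.
rewrite (_ : ord0 \notin _) ?add1n; last first.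
  by apply/imsetP => -[v _ /(congr1 val)].
rewrite cardsD (setIidPr _).
  by rewrite [#|[set v in s]|]cardsE (card_uniqP su).
by apply/subsetP => v; rewrite inE => /(allP sG).
Qed.

(** The falling factorial counts the ordered lists of [i - k'] roots among [i]; it equals i!/k'! for
    [k' <= i], and the Toeplitz factor vanishes otherwise. Column 0 is zero because a nonempty
    forest has a root. *)
Definition lah_production (R : comNzRingType) (phi : nat -> R) (i k : nat) : R :=
  if k is k'.+1 then (i ^_ (i - k'))%:R * toeplitz_mx phi i k' else 0.

(** With [A] the roots of a forest, leaving [k] of them ungrafted fixes the length [#|A| - k] of the
    list, so every term is the same. The column is [k.+1] because the new vertex is also a root. *)
Lemma sum_root_lists (R : comNzRingType) (phi : nat -> R) n (A : {set 'I_n})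
    (k : nat) :
  \sum_(s : {bseq n of 'I_n} | all (mem A) s && uniq s && (#|A| - size s == k)%N)
    phi (size s) = lah_production phi #|A| k.+1.
Proof.
have sizeA (s : {bseq n of 'I_n}) : all (mem A) s -> uniq s -> (size s <= #|A|)%N.
  move=> sA /card_uniqP <-; apply: subset_leq_card.
  by apply/subsetP => v /(allP sA).
have An : (#|A| <= n)%N by rewrite -[X in (_ <= X)%N]card_ord max_card.
have subE (d a : nat) : (d <= a -> k <= a -> (a - d == k) = (d == a - k))%N by lia.
rewrite /= /toeplitz_mx; case: leqP => kA; last first.
  by rewrite mulr0 big_pred0 // => s; apply/negP => /andP[/andP[_ _] /eqP e]; lia.
transitivity (\sum_(s in [set s : {bseq n of 'I_n} |
    [&& all (mem A) s, uniq s & size s == (#|A| - k)%N]]) phi (#|A| - k)%N).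
  apply: eq_big => [s|s]; rewrite ?inE.
    rewrite -andbA; case sA: all => //=; case su: uniq => //=.
    exact: subE (sizeA s sA su) kA.
  by move=> /andP[/andP[sA su]]; rewrite subE ?sizeA // => /eqP ->.
rewrite sumr_const card_uniq_bseqs; last exact: leq_trans (leq_subr _ _) An.
by rewrite mulr_natl.
Qed.

Lemma Lah_recurrence (R : comNzRingType) (phi : nat -> R) n k :
  Lah phi n.+1 k = \sum_(i < n.+1) Lah phi n i * lah_production phi i k.
Proof.
case: k => [|k]; first by rewrite LahS0 big1 // => i _; rewrite mulr0.
transitivity (\sum_(G : child_lists n | increasing_forest G)
    (\prod_v phi (deg G v)) * lah_production phi #|roots G| k.+1).
  rewrite /Lah (reindex_onto (@attach n) (@detach n)); last first.
    by move=> F /andP[/detachK].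
  under [RHS]eq_bigr do rewrite -sum_root_lists big_distrr /=.
  rewrite pair_big_dep /=; apply: eq_big => [[G s]|[G s] _] /=.
    rewrite attachK eqxx andbT increasing_attach.
    case: (increasing_forest G) => //=; case sG: all => //=; case su: uniq => //=.
    by rewrite card_roots_attach.
  rewrite big_ord_recl /deg attach0 size_lift_bseq mulrC; congr (_ * _).
  by apply: eq_bigr => v _; rewrite attach_lift size_lift_bseq.
(* Group the forests by their number of roots, which is at most [n], so that [inord] is faithful. *)
rewrite (partition_big
  (fun G : child_lists n => inord #|roots G| : 'I_n.+1) xpredT) //=.
apply: eq_bigr => i _; rewrite /Lah big_distrl /=.
have rn (G : child_lists n) : (#|roots G| < n.+1)%N.
  by rewrite ltnS -[X in (_ <= X)%N]card_ord max_card.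
apply: eq_big => [G|G /andP[_ /eqP <-]]; last by rewrite inordK.
by congr andb; rewrite -val_eqE /= inordK.
Qed.

Lemma Lah_output (R : comNzRingType) (phi : nat -> R) n k :
  Lah phi n k = output (lah_production phi) n k.
Proof.
elim: n k => [|n IHn] k; first exact: Lah0n.
by rewrite Lah_recurrence /=; apply: eq_bigr => i _; rewrite IHn.
Qed.

Lemma toeplitz_eq0 (R : comNzRingType) (phi : nat -> R) i j :
  (i < j)%N -> toeplitz_mx phi i j = 0.
Proof. by move=> ij; rewrite /toeplitz_mx leqNgt ij. Qed.

Lemma TP_lah_production (R : comNzRingType) (P : R -> Prop)
    (hP : is_nonneg_cone P) r (phi : nat -> R) :
  ToeplitzTP P r phi -> TP P r (lah_production phi).
Proof.
move=> hphi; apply: TP_zero_col => //; apply: TP_ffact_scale => //.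
exact: toeplitz_eq0.
Qed.

Lemma hessenberg_lah_production (R : comNzRingType) (phi : nat -> R) :
  hessenberg (lah_production phi).
Proof. by move=> i [|k] //= ik; rewrite toeplitz_eq0 ?mulr0. Qed.

(** * Row-generating polynomials *)

(* This is [lah_production] times [1 + y Delta^T], where [Delta] has ones on the
   superdiagonal; it is the conjugate of [lah_production] by the binomial matrix
   [('C(j, k) y^(j-k))_(j, k)]. *)
Definition lah_poly_production (R : comNzRingType) (phi : nat -> R) (i k : nat)
    : {poly R} :=
  (lah_production phi i k)%:P + (lah_production phi i k.+1)%:P * 'X.

Lemma hessenberg_lah_poly_production (R : comNzRingType) (phi : nat -> R) :
  hessenberg (lah_poly_production phi).
Proof.
move=> i k ik; rewrite /lah_poly_production !hessenberg_lah_production //.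
  by rewrite mul0r addr0.
exact: ltnW.
Qed.

Lemma TP_lah_poly_production (R : comNzRingType) (P : R -> Prop)
    (hP : is_nonneg_cone P) r (phi : nat -> R) :
  ToeplitzTP P r phi -> TP (coefwise P) r (lah_poly_production phi).
Proof.
move=> /(TP_lah_production hP)/(TP_polyC hP) TPp.
have hPX := coefwise_cone hP.
have PX : coefwise P ('X : {poly R}).
  by move=> i; rewrite coefX; apply: cone_natr.
apply: (TP_mxprod (b := fun _ k => k.+2) hPX _ TPp (TP_bidiagonal hPX PX)).
move=> i k N kN; pose k0 : 'I_N := Ordinal (ltnW kN); pose k1 : 'I_N := Ordinal kN.
under eq_bigr do rewrite mulrDr.
(* Column [k] of the bidiagonal factor is supported on rows [k] and [k.+1]. *)
rewrite big_split /= (bigD1 k0) //= (bigD1 k1 (P := xpredT)) //= !eqxx.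
rewrite [X in _ * _ + X + _]big1 ?[X in _ + (_ * _ + X)]big1 ?addr0 ?mulr1 //.
  by move=> j jk; rewrite (_ : (j == k.+1 :> nat) = false) ?mulr0 //; apply: negbTE.
by move=> j jk; rewrite (_ : (j == k :> nat) = false) ?mulr0 //; apply: negbTE.
Qed.

Lemma ffactnD n d k : (n ^_ (d + k) = n ^_ d * (n - d) ^_ k)%N.
Proof.
elim: k => [|k IHk]; first by rewrite addn0 muln1.
by rewrite addnS !ffactnSr IHk subnDA mulnA.
Qed.

(** Multiplied by k!, both sides become [n ^_ (d + k)]. *)
Lemma bin_mul_ffact n d k :
  ('C(n, d + k) * (d + k) ^_ d = n ^_ d * 'C(n - d, k))%N.
Proof.
apply/eqP; rewrite -(eqn_pmul2r (fact_gt0 k)); apply/eqP.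
rewrite -!mulnA [X in _ = (_ * X)%N]bin_ffact -ffactnD.
rewrite -[X in (_ * (_ * X`!))%N](addKn d).
by rewrite ffact_fact ?leq_addr // bin_ffact.
Qed.

Lemma sum_shift (R : comNzRingType) (f : nat -> nat -> R) M k :
  (forall i d, (M <= i)%N -> f i d = 0) ->
  \sum_(i < M) (if (k <= i)%N then f i (i - k)%N else 0) =
    \sum_(d < M) f (d + k)%N d.
Proof.
move=> f0.
rewrite (@sum_ord_widen _ M (k + M)%N
  (fun i => if (k <= i)%N then f i (i - k)%N else 0)).
- rewrite big_split_ord /= big1 ?add0r.
    by apply: eq_bigr => i _; rewrite leq_addr addKn addnC.
  by move=> i _; rewrite leqNgt ltn_ord.
- exact: leq_addl.
- by move=> i Mi; rewrite f0 // if_same.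
Qed.

Definition binomial_mx (R : comNzRingType) (j k : nat) : {poly R} :=
  'C(j, k)%:R * 'X^(j - k).

Lemma sum_binomial_production (R : comNzRingType) (phi : nat -> R) n k :
  \sum_(i < n.+1) binomial_mx R n i * (lah_production phi i k.+1)%:P =
  \sum_(d < n.+1) (n ^_ d * 'C(n - d, k))%:R * 'X^(n - d - k) * (phi d)%:P.
Proof.
pose f i d := binomial_mx R n i * ((i ^_ d)%:R * phi d)%:P.
transitivity (\sum_(i < n.+1) (if (k <= i)%N then f i (i - k)%N else 0)).
  apply: eq_bigr => i _; rewrite /f /= /toeplitz_mx.
  by case: ifP => // _; rewrite mulr0 polyC0 mulr0.
rewrite sum_shift => [|i d ni]; last by rewrite /f /binomial_mx bin_small ?mul0r.
apply: eq_bigr => d _; rewrite /f /binomial_mx polyCM polyC_natr subnDA.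
by rewrite -bin_mul_ffact natrM mulrA; congr (_ * _); rewrite mulrAC.
Qed.

(** With B the binomial matrix, p [lah_production] and q [lah_poly_production], this is pB = Bq.
    Both sides are expanded along the [phi d], and their coefficients agree by Pascal's rule. *)
Lemma binomial_mx_intertwine (R : comNzRingType) (phi : nat -> R) n k :
  \sum_(j < n.+2) (lah_production phi n j)%:P * binomial_mx R j k =
  \sum_(i < n.+1) binomial_mx R n i * lah_poly_production phi i k.
Proof.
have -> : \sum_(j < n.+2) (lah_production phi n j)%:P * binomial_mx R j k =
    \sum_(d < n.+1) (n ^_ d * 'C((n - d).+1, k))%:R * 'X^((n - d).+1 - k) * (phi d)%:P.
  rewrite big_ord_recl /= polyC0 mul0r add0r (reindex_inj rev_ord_inj) /=.
  apply: eq_bigr => d _; rewrite /toeplitz_mx subSS leq_subr.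
  rewrite (subKn (leq_ord d)) polyCM polyC_natr /binomial_mx natrM.
  by rewrite /bump /= add1n mulrA [RHS]mulrAC; congr (_ * _); rewrite mulrAC.
under [RHS]eq_bigr do rewrite mulrDr mulrA.
rewrite big_split /= -mulr_suml sum_binomial_production mulr_suml.
case: k => [|k].
  rewrite [X in X + _]big1 ?add0r => [|i _]; last by rewrite polyC0 mulr0.
  by apply: eq_bigr => d _; rewrite !bin0 !subn0 exprSr mulrA mulrAC.
rewrite sum_binomial_production -big_split /=; apply: eq_bigr => d _.
rewrite binS mulnDr natrD subSS addrC !mulrDl; congr (_ + _).
(* The exponents match only if [n - d - k] is positive; otherwise the binomial coefficient is
   zero. *)
case: (ltnP k (n - d)) => kd.
  by rewrite -[(n - d - k)%N]prednK ?subn_gt0 // -subnS exprSr mulrA mulrAC.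
by rewrite bin_small // muln0 !mul0r.
Qed.

(** By induction, row [n.+1] for q is (row [n] of L) Bq = (row [n] of L) pB, hence row [n.+1] of LB;
    at [n = 0] it holds because row 0 of B is a unit vector. *)
Lemma lah_poly_outputE (R : comNzRingType) (phi : nat -> R) n k :
  output (lah_poly_production phi) n k =
    \sum_(j < n.+1) (Lah phi n j)%:P * binomial_mx R j k.
Proof.
elim: n k => [|n IHn] k /=.
  rewrite big_ord1 Lah0n eqxx polyC1 mul1r /binomial_mx sub0n expr0 mulr1.
  by case: k.
under eq_bigr do rewrite IHn big_distrl /=.
rewrite exchange_big /=.
(* The intertwining relation for row [j], with its sums extended by zeros to bounds independent of
   [j] so that sums can be exchanged. *)
have widen (j : 'I_n.+1) :
    \sum_(i < n.+1) binomial_mx R j i * lah_poly_production phi i k =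
    \sum_(l < n.+2) (lah_production phi j l)%:P * binomial_mx R l k.
  have jn : (j.+1 <= n.+1)%N by [].
  have jn2 : (j.+2 <= n.+2)%N by [].
  rewrite -(@sum_ord_widen _ _ _
    (fun i => binomial_mx R j i * lah_poly_production phi i k) jn).
    rewrite -binomial_mx_intertwine; apply: (@sum_ord_widen _ _ _
      (fun l => (lah_production phi j l)%:P * binomial_mx R l k) jn2) => i ji.
    by rewrite hessenberg_lah_production // polyC0 mul0r.
  by move=> i ji; rewrite /binomial_mx bin_small // !mul0r.
under eq_bigr => j _.
  under eq_bigr do rewrite -mulrA.
  rewrite -mulr_sumr widen mulr_sumr; over.
rewrite exchange_big; apply: eq_bigr => l _ /=.
rewrite Lah_recurrence (big_morph polyC (@polyCD R) (polyC0 R)) big_distrl /=.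
by apply: eq_bigr => j _; rewrite polyCM mulrA.
Qed.

Lemma Lah_poly_output (R : comNzRingType) (phi : nat -> R) n :
  Lah_poly phi n = output (lah_poly_production phi) n 0.
Proof.
rewrite lah_poly_outputE; apply: eq_bigr => j _.
by rewrite /binomial_mx bin0 mul1r subn0 mul_polyC.
Qed.

(** * Trees *)

(** Column 0 of the Lah matrix vanishes from row 1 on, so these rows obey the recurrence with row
    and column 0 of the production matrix deleted. The factor [phi 0] is the weight of the
    one-vertex forest in row 1. *)
Lemma Lah_shift_output (R : comNzRingType) (phi : nat -> R) n k :
  Lah phi n.+1 k.+1 =
    phi 0%N * output (fun i j => lah_production phi i.+1 j.+1) n k.
Proof.
elim: n k => [|n IHn] k.
  rewrite Lah_recurrence big_ord1 Lah0n eqxx mul1r /= ffact0n /toeplitz_mx leqn0.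
  by case: k => [|k]; rewrite ?mulr0 // mul1r mulr1.
rewrite Lah_recurrence big_ord_recl LahS0 mul0r add0r [output _ _ _]/= big_distrr /=.
by apply: eq_bigr => i _; rewrite /bump /= add1n IHn -!mulrA.
Qed.

Lemma ToeplitzTP_ge0 (R : comNzRingType) (P : R -> Prop) r (phi : nat -> R) :
  le_ord 1 r -> ToeplitzTP P r phi -> P (phi 0%N).
Proof.
move=> hr /(_ 1%N (fun=> 0%N) (fun=> 0%N) hr).
by rewrite /minor det_mx11 mxE; apply => i j; rewrite !ord1.
Qed.

Theorem theorem1p1 (r : option nat) (hr : le_ord 1 r)
    (R : comNzRingType) (P : R -> Prop) (hP : is_nonneg_cone P)
    (phi : nat -> R) (hphi : ToeplitzTP P r phi) :
  [/\ TP P r (Lah phi),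
      HankelTP (coefwise P) r (Lah_poly phi)
    & HankelTP P r (fun n : nat => Lah phi n.+1 1)].
Proof.
have TPp := TP_lah_production hP hphi.
have hessp := hessenberg_lah_production phi.
split.
- apply: (eq_TP _ (TP_output hP hessp TPp)) => i j.
  by rewrite Lah_output.
- have hessq := hessenberg_lah_poly_production phi.
  apply: (eq_TP _ (HankelTP_output (coefwise_cone hP) hessq
    (TP_lah_poly_production hP hphi))) => i j.
  by rewrite /hankel_mx Lah_poly_output.
- have hesss : hessenberg (fun i j => lah_production phi i.+1 j.+1).
    by move=> i k ik; apply: hessp.
  (* Nonnegativity of [phi 0] is a minor of size 1, available because [r] is at least 1. *)
  have Pphi0 := ToeplitzTP_ge0 hr hphi.
  apply: (eq_TP _ (TP_scale hP Pphi0 (HankelTP_output hP hesss (TP_shift TPp)))).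
  by move=> i j; rewrite /hankel_mx Lah_shift_output.
Qed.
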